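(* Let $B\in\mathrm{Sym}^{++}(3)$ and let $\nu_1,\nu_2,\nu_3\ge0$. Then $\mathbb{A}^{\circ}(B):\mathrm{Sym}(3)\to\mathrm{Sym}(3)$ given by $$\mathbb{A}^{\circ}(B).D = D B + B D + \frac{\nu_1}{2}\big(B[B,D]-[B,D]B\big)+\frac{\nu_2}{2}\big(B^2[B,D]-[B,D]B^2\big)+\frac{\nu_3}{2}\big(B^2[B,D]B-B[B,D]B^2\big)$$ is positive definite, i.e. $$\langle\mathbb{A}^{\circ}(B).D,D\rangle = 2\langle BD,D\rangle+\frac{\nu_1}{2}\|[B,D]\|^2+\nu_2\langle B^2D,[B,D]\rangle+\nu_3\langle B^2DB,[B,D]\rangle>0\qquad\text{for all } D\in\mathrm{Sym}(3)\setminus\{0\},$$ and hence $\mathbb{A}^{\circ}(B)\in\mathrm{Sym}^{++}_4(6)$.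
   Context: $\mathrm{Sym}(3)$ denotes the real symmetric $3\times3$ matrices, $\mathrm{Sym}^{++}(3)$ the positive definite ones; $[X,Y]=XY-YX$; $\langle X,Y\rangle=\mathrm{tr}(XY^T)$, $\|X\|^2=\langle X,X\rangle$. $\mathrm{Sym}^{++}_4(6)$ is the set of linear maps $\mathbb{C}:\mathrm{Sym}(3)\to\mathrm{Sym}(3)$ that are self-adjoint with respect to $\langle\cdot,\cdot\rangle$ (major symmetric) and positive definite, $\langle\mathbb{C}.D,D\rangle>0$ for $D\neq0$. In the paper $\nu_1,\nu_2,\nu_3$ are isotropic scalar invariants of $B$, so for fixed $B$ they are real numbers. *)

(* Defs.v *)
From HB Require Import structures.
From mathcomp Require Import all_boot all_order all_algebra.
From mathcomp Require Import reals.

Set Implicit Arguments.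
Unset Strict Implicit.
Unset Printing Implicit Defensive.

Import GRing.Theory Num.Theory.
Local Open Scope ring_scope.

Definition inner (R : realType) (X Y : 'M[R]_3) : R := \tr (X *m Y^T).

Definition fnorm (R : realType) (X : 'M[R]_3) : R := Num.sqrt (inner X X).

Definition comm (R : realType) (X Y : 'M[R]_3) : 'M[R]_3 := X *m Y - Y *m X.

(* Sym(3) is a subtype of 'M[R]_3 from which it inherits, below, its vector
   space structure; products such as B *m D are formed in 'M[R]_3. *)
Definition sym3 (R : realType) : pred 'M[R]_3 := fun X => X \is symmetricmx.

Record Sym3 (R : realType) := MkSym3 { symmx :> 'M[R]_3; _ : sym3 symmx }.

HB.instance Definition _ (R : realType) := [isSub for @symmx R].
HB.instance Definition _ (R : realType) := [Choice of Sym3 R by <:].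

Lemma sym3P (R : realType) (X : 'M[R]_3) : reflect (X^T = X) (sym3 X).
Proof.
rewrite /sym3 qualifE /= expr0 scale1r map_mx_id // eq_sym.
exact: eqP.
Qed.

Lemma sym3_submod (R : realType) : submod_closed (@sym3 R).
Proof.
split=> [|a X Y /sym3P hX /sym3P hY]; apply/sym3P; first by rewrite trmx0.
by rewrite linearD linearZ /= hX hY.
Qed.

HB.instance Definition _ (R : realType) :=
  GRing.isSubmodClosed.Build R 'M[R]_3 (@sym3 R) (@sym3_submod R).
HB.instance Definition _ (R : realType) :=
  [SubChoice_isSubLmodule of Sym3 R by <:].

Lemma tr_symmx (R : realType) (X : Sym3 R) : (symmx X)^T = symmx X.
Proof. by apply/sym3P; case: X. Qed.

(* Membership in Sym++(3) of a symmetric matrix. *)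
Definition posdef3 (R : realType) (B : Sym3 R) : Prop :=
  forall x : 'cV[R]_3, x != 0 -> 0 < (x^T *m B *m x) 0 0.

Definition posdef4 (R : realType) (C : Sym3 R -> Sym3 R) : Prop :=
  forall D : Sym3 R, D != 0 -> 0 < inner (C D) D.

Definition major_symmetric (R : realType) (C : Sym3 R -> Sym3 R) : Prop :=
  forall D E : Sym3 R, inner (C D) E = inner D (C E).

(* Sym4++(6) *)
Definition Sym4pp (R : realType) (C : Sym3 R -> Sym3 R) : Prop :=
  [/\ linear C, major_symmetric C & posdef4 C].

Definition Acirc_mx (R : realType) (nu1 nu2 nu3 : R) (B D : 'M[R]_3) :
    'M[R]_3 :=
  D *m B + B *m D
  + (nu1 / 2) *: (B *m comm B D - comm B D *m B)
  + (nu2 / 2) *: (B ^+ 2 *m comm B D - comm B D *m B ^+ 2)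
  + (nu3 / 2) *: (B ^+ 2 *m comm B D *m B - B *m comm B D *m B ^+ 2).

Lemma Acirc_sym (R : realType) (nu1 nu2 nu3 : R) (B D : Sym3 R) :
  sym3 (Acirc_mx nu1 nu2 nu3 B D).
Proof.
have tB := tr_symmx B; have tD := tr_symmx D.
have tW : (comm B D)^T = - comm B D.
  by rewrite /comm linearB /= !trmx_mul tB tD opprB.
have tB2 : (symmx B ^+ 2)^T = symmx B ^+ 2 by rewrite expr2 trmx_mul tB.
rewrite /Acirc_mx; move: (comm B D) (symmx B ^+ 2) tW tB2 => W B2 tW tB2.
have tDr (X Y : 'M[R]_3) : (X + Y)^T = X^T + Y^T by rewrite linearD.
have tN (X : 'M[R]_3) : (- X)^T = - X^T by rewrite linearN.
have tZ (a : R) (X : 'M[R]_3) : (a *: X)^T = a *: X^T by rewrite linearZ.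
apply/sym3P; rewrite !(tDr, tZ, tN, trmx_mul) tB tD tB2 tW.
rewrite !(mulmxN, mulNmx, opprK, mulmxA) [B *m D + _]addrC.
by congr (_ + _ *: _ + _ *: _ + _ *: _); rewrite addrC.
Qed.

Definition Acirc (R : realType) (nu1 nu2 nu3 : R) (B D : Sym3 R) : Sym3 R :=
  MkSym3 (Acirc_sym nu1 nu2 nu3 B D).

(* Main.v *)
Require Import Defs.
From mathcomp Require Import all_boot all_order all_algebra.
From mathcomp Require Import reals.
From mathcomp Require Import ring.

Import Order.TTheory GRing.Theory Num.Theory.
Local Open Scope ring_scope.

(** Write W = [B, D], a skew-symmetric matrix when B and D are symmetric.
    Multiplication by a symmetric matrix is self-adjoint for the trace inner
    product, so in <A(B).D, E> the outer products by B can be moved onto E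
    ([inner_Acirc]); up to the factors nu_k / 2,
      - the nu1 term becomes <[B,D], [B,E]>;
      - since [B^2, E] = B[B,E] + [B,E]B, the nu2 term becomes
        <[B,D], B[B,E] + [B,E]B>;
      - since B^2 E B - B E B^2 = B[B,E]B, the nu3 term becomes
        <[B,D], B[B,E]B>.
    These, like <DB + BD, E>, are symmetric in D and E, which is major
    symmetry; and a self-adjoint map for a definite inner product is
    automatically linear.

    On the diagonal D = E, skew-symmetry of W identifies these terms with those
    of the quadratic form in the theorem, and it remains to check their signs.
    The term <DB + BD, D> = 2 <BD, D> is twice the sum of the quadratic form of B
    over the columns of D, hence positive for D <> 0.  The same computation gives
    <W, BW + WB> = 2 <BW, W> >= 0.  Finally a Cholesky factorization B = M^T M
    turns <BWB, W> into the squared norm of M W M^T.  Factoring B avoids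
    diagonalizing it: in an eigenbasis with eigenvalues b_i, the nu2 and nu3
    terms are sums of (b_i + b_j) (b_i - b_j)^2 d_ij^2 and of
    b_i b_j (b_i - b_j)^2 d_ij^2. *)

(** * Cholesky factorization *)

(** By induction on the size: splitting off the first coordinate, the Schur
    complement of the corner entry is again positive definite. *)
Lemma cholesky (R : rcfType) (n : nat) (B : 'M[R]_n) :
  B^T = B ->
  (forall x : 'cV[R]_n, x != 0 -> 0 < (x^T *m B *m x) 0 0) ->
  exists M : 'M[R]_n, B = M^T *m M.
Proof.
elim: n B => [|n IHn]; first by move=> B _ _; exists 0; apply/matrixP => -[].
rewrite -[n.+1]/(1 + n)%N => B tB posB.
pose a := ulsubmx B 0 0; pose u := ursubmx B; pose C := drsubmx B.
have defB : B = block_mx a%:M u u^T C.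
  by rewrite -[LHS]submxK -mx11_scalar /u trmx_ursub tB.
have tC : C^T = C by rewrite /C trmx_drsub tB.
have a_gt0 : 0 < a.
  have e_neq0 : col_mx 1%:M 0 != 0 :> 'cV[R]_(1 + n).
    by rewrite col_mx_eq0 oner_eq0.
  have := posB _ e_neq0; rewrite defB tr_col_mx trmx0 trmx1.
  rewrite -mulmxA mul_block_col mul_row_col !mulmx0 !mul0mx mulmx1 mul1mx.
  by rewrite !addr0 mxE eqxx.
have a_neq0 : a != 0 by rewrite gt_eqF.
pose S := C - a^-1 *: (u^T *m u).
have [||N defS] := IHn S.
- by rewrite /S linearB linearZ /= trmx_mul trmxK tC.
- move=> y y_neq0.
  (* Minimizing the form of B over the first coordinate leaves that of S. *)
  pose x : 'cV[R]_(1 + n) := col_mx (- (a^-1 *: (u *m y))) y.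
  have x_neq0 : x != 0 by rewrite col_mx_eq0 negb_and y_neq0 orbT.
  have := posB _ x_neq0; rewrite defB -mulmxA mul_block_col.
  rewrite mul_scalar_mx scalerN scalerA mulfV // scale1r addNr.
  rewrite tr_col_mx mul_row_col mulmx0 add0r mulmxN -scalemxAr.
  rewrite (_ : _ + _ = S *m y) ?mulmxA //.
  by rewrite /S mulmxBl -scalemxAl addrC.
pose r := Num.sqrt a.
have rr : r * r = a by rewrite -expr2 sqr_sqrtr // ltW.
have r_neq0 : r != 0 by rewrite gt_eqF // sqrtr_gt0.
(* First row of the Cholesky factor: the first row of B divided by r. *)
exists (block_mx r%:M (r^-1 *: u) 0 N).
rewrite {1}defB tr_block_mx mulmx_block.
rewrite trmx0 !(mul0mx, mulmx0, addr0) tr_scalar_mx [(r^-1 *: u)^T]linearZ /=.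
rewrite -scalar_mxM rr mul_scalar_mx mul_mx_scalar !scalerA mulfV // !scale1r.
rewrite -scalemxAl -scalemxAr scalerA -invfM rr -defS.
by rewrite /S addrC subrK.
Qed.

(** * The trace inner product *)

Section Inner.
Variable R : realType.
Implicit Types A X Y Z : 'M[R]_3.

Lemma innerC X Y : inner X Y = inner Y X.
Proof. by rewrite /inner -mxtrace_tr trmx_mul trmxK. Qed.

Lemma inner_tr X Y : inner X^T Y^T = inner X Y.
Proof. by rewrite /inner trmxK mxtrace_mulC -/(inner Y X) innerC. Qed.

Lemma innerDl X Y Z : inner (X + Y) Z = inner X Z + inner Y Z.
Proof. by rewrite /inner mulmxDl linearD. Qed.

Lemma innerNl X Z : inner (- X) Z = - inner X Z.
Proof. by rewrite /inner mulNmx linearN. Qed.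

Lemma innerZl c X Z : inner (c *: X) Z = c * inner X Z.
Proof. by rewrite /inner -scalemxAl linearZ. Qed.

Lemma innerDr X Y Z : inner Z (X + Y) = inner Z X + inner Z Y.
Proof. by rewrite ![inner Z _]innerC innerDl. Qed.

Lemma innerNr X Z : inner Z (- X) = - inner Z X.
Proof. by rewrite ![inner Z _]innerC innerNl. Qed.

Lemma inner_mull A X Y : inner (A *m X) Y = inner X (A^T *m Y).
Proof. by rewrite /inner trmx_mul trmxK -mulmxA mxtrace_mulC mulmxA. Qed.

Lemma inner_mulr A X Y : inner (X *m A) Y = inner X (Y *m A^T).
Proof. by rewrite /inner trmx_mul trmxK -mulmxA. Qed.

Lemma inner_ge0 X : 0 <= inner X X.
Proof.
apply: sumr_ge0 => i _; rewrite mxE; apply: sumr_ge0 => j _.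
by rewrite mxE -expr2 sqr_ge0.
Qed.

Lemma inner_eq0 X : inner X X = 0 -> X = 0.
Proof.
have sq i j : 0 <= X i j * X^T j i by rewrite mxE -expr2 sqr_ge0.
move/eqP; rewrite /inner /mxtrace psumr_eq0 => [/allP X0|i _]; last first.
  by rewrite mxE sumr_ge0.
apply/matrixP => i j; have := X0 i; rewrite mem_index_enum mxE => /(_ isT).
rewrite psumr_eq0 // => /allP/(_ j); rewrite mem_index_enum => /(_ isT).
by rewrite !mxE mulf_eq0 orbb => /eqP.
Qed.

Lemma fnorm_sqr X : fnorm X ^+ 2 = inner X X.
Proof. exact/sqr_sqrtr/inner_ge0. Qed.

Lemma inner_mull_sum_col A X :
  inner (A *m X) X = \sum_j ((col j X)^T *m A *m col j X) 0 0.
Proof.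
rewrite /inner mxtrace_mulC mulmxA.
apply: eq_bigr => j _; rewrite mxE [RHS]mxE.
by apply: eq_bigr => k _; rewrite tr_col -row_mul !mxE.
Qed.

Lemma inner_mull_gt0 A X :
  (forall x : 'cV[R]_3, x != 0 -> 0 < (x^T *m A *m x) 0 0) -> X != 0 ->
  0 < inner (A *m X) X.
Proof.
move=> posA X_neq0; rewrite inner_mull_sum_col.
have form_ge0 (x : 'cV[R]_3) : 0 <= (x^T *m A *m x) 0 0.
  by have [->|/posA/ltW//] := eqVneq x 0; rewrite mulmx0 mxE.
have [j colj_neq0] : exists j, col j X != 0.
  apply/existsP; apply: contraNT X_neq0 => /existsPn col0.
  apply/eqP/matrixP => i j; have /negPn/eqP/colP/(_ i) := col0 j.
  by rewrite !mxE.
rewrite (bigD1 j) //= ltr_pwDl ?posA // sumr_ge0 // => i _.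
Qed.

Lemma inner_mull_ge0 A X :
  (forall x : 'cV[R]_3, x != 0 -> 0 < (x^T *m A *m x) 0 0) ->
  0 <= inner (A *m X) X.
Proof.
move=> posA; have [->|/(inner_mull_gt0 _ _ posA)/ltW//] := eqVneq X 0.
by rewrite mulmx0 inner_ge0.
Qed.

(** With A = M^T M, the left-hand inner product is the squared norm of
    M X M^T. *)
Lemma inner_conj_ge0 A X : A^T = A ->
  (forall x : 'cV[R]_3, x != 0 -> 0 < (x^T *m A *m x) 0 0) ->
  0 <= inner (A *m X *m A) X.
Proof.
move=> tA /(cholesky _ _ _ tA)[M ->].
have -> : inner (M^T *m M *m X *m (M^T *m M)) X
    = inner (M *m X *m M^T) (M *m X *m M^T).
  by rewrite !mulmxA inner_mulr -!mulmxA inner_mull trmxK !mulmxA.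
exact: inner_ge0.
Qed.

End Inner.

(** The defect of linearity F = C (c D + E) - c (C D) - C E satisfies
    <F, F> = <c D + E, C F> - c <D, C F> - <E, C F> = 0. *)
Lemma major_symmetric_linear (R : realType) (C : Sym3 R -> Sym3 R) :
  major_symmetric C -> linear C.
Proof.
move=> symC c D E; set F := C (c *: D + E) - (c *: C D + C E).
suff F0 : inner F F = 0.
  by apply/eqP; rewrite -subr_eq0; apply/eqP/val_inj/inner_eq0.
rewrite {1}/F innerDl innerNl innerDl innerZl !symC /=.
by rewrite innerDl innerZl subrr.
Qed.

(** * The map A(B) *)

Section Acirc.
Variables (R : realType) (B : Sym3 R).
Implicit Types (D E : Sym3 R) (W X : 'M[R]_3).

Lemma comm_anti D : (comm B D)^T = - comm B D.
Proof. by rewrite /comm linearB /= !trmx_mul !tr_symmx opprB. Qed.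

Lemma inner_anti_tr X W : W^T = - W -> inner X^T W = - inner X W.
Proof. by move=> tW; rewrite -inner_tr trmxK tW innerNr. Qed.

(** Moving the factors B onto E makes the symmetry in D and E visible, and on
    the diagonal leaves expressions of known sign. *)
Lemma inner_Acirc nu1 nu2 nu3 D E :
  inner (Acirc nu1 nu2 nu3 B D) E
  = inner (D *m B + B *m D) E
    + nu1 / 2 * inner (comm B D) (comm B E)
    + nu2 / 2 * inner (comm B D) (B *m comm B E + comm B E *m B)
    + nu3 / 2 * inner (comm B D) (B *m comm B E *m B).
Proof.
have tB := tr_symmx B.
have tB2 : (symmx B ^+ 2)^T = symmx B ^+ 2 by rewrite expr2 trmx_mul tB.
rewrite /Acirc /= /Acirc_mx; move: (comm B D) => W.
have sandwich (P Q : 'M[R]_3) : P^T = P -> Q^T = Q ->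
    inner (P *m W *m Q) E = inner W (P *m E *m Q).
  by move=> tP tQ; rewrite inner_mulr inner_mull tP tQ mulmxA.
have commute (P : 'M[R]_3) : P^T = P ->
    inner (P *m W - W *m P) E = inner W (comm P E).
  move=> tP; rewrite innerDl innerNl inner_mull inner_mulr tP.
  by rewrite -innerNr -innerDr.
rewrite [LHS]innerDl innerDl innerDl !innerZl !commute //.
rewrite [inner (_ - _) E]innerDl innerNl !sandwich // -innerNr -innerDr.
congr (_ + _ * inner _ _ + _ * inner _ _).
- by rewrite /comm expr2 -mulmxE !(mulmxBl, mulmxBr) !mulmxA addrA subrK.
- by rewrite /comm expr2 -mulmxE !(mulmxBl, mulmxBr) !mulmxA.
Qed.

(** Transposing D B^2 against the skew-symmetric [B, D] gives
    <D B^2, [B,D]> = - <B^2 D, [B,D]>, so twice the left inner product is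
    <[B^2, D], [B,D]>, where [B^2, D] = B[B,D] + [B,D]B. *)
Lemma inner_sqr_comm D :
  2 * inner (symmx B ^+ 2 *m D) (comm B D)
  = inner (comm B D) (B *m comm B D + comm B D *m B).
Proof.
set W := comm B D; have tB := tr_symmx B; have tD := tr_symmx D.
have e : inner (D *m symmx B ^+ 2) W = - inner (symmx B ^+ 2 *m D) W.
  rewrite -inner_anti_tr ?comm_anti //; congr inner.
  by rewrite trmx_mul tD expr2 trmx_mul tB.
rewrite [RHS]innerC.
have -> : B *m W + W *m B = symmx B ^+ 2 *m D - D *m symmx B ^+ 2.
  by rewrite /W /comm expr2 -mulmxE !(mulmxBl, mulmxBr) !mulmxA addrA subrK.
by rewrite innerDl innerNl e opprK mulr2n mulrDl mul1r.
Qed.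

(** As for the previous identity, now with
    B^2 D B - B D B^2 = B[B,D]B. *)
Lemma inner_sqr_mul_comm D :
  2 * inner (symmx B ^+ 2 *m D *m B) (comm B D)
  = inner (comm B D) (B *m comm B D *m B).
Proof.
set W := comm B D; have tB := tr_symmx B; have tD := tr_symmx D.
have e : inner (B *m D *m symmx B ^+ 2) W = - inner (symmx B ^+ 2 *m D *m B) W.
  rewrite -inner_anti_tr ?comm_anti //; congr inner.
  by rewrite !trmx_mul tD tB expr2 !mulmxA.
rewrite [RHS]innerC.
have -> : B *m W *m B = symmx B ^+ 2 *m D *m B - B *m D *m symmx B ^+ 2.
  by rewrite /W /comm expr2 -mulmxE !(mulmxBl, mulmxBr) !mulmxA.
by rewrite innerDl innerNl e opprK mulr2n mulrDl mul1r.
Qed.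

Lemma inner_anticomm D : inner (D *m B + B *m D) D = 2 * inner (B *m D) D.
Proof.
by rewrite innerDl -inner_tr trmx_mul !tr_symmx mulr2n mulrDl mul1r.
Qed.

Lemma inner_Acirc_diag nu1 nu2 nu3 D :
  inner (Acirc nu1 nu2 nu3 B D) D
  = 2 * inner (B *m D) D
    + nu1 / 2 * fnorm (comm B D) ^+ 2
    + nu2 * inner (symmx B ^+ 2 *m D) (comm B D)
    + nu3 * inner (symmx B ^+ 2 *m D *m B) (comm B D).
Proof.
rewrite inner_Acirc inner_anticomm fnorm_sqr.
by rewrite -inner_sqr_comm -inner_sqr_mul_comm; field.
Qed.

Lemma Acirc_major_symmetric nu1 nu2 nu3 :
  major_symmetric (Acirc nu1 nu2 nu3 B).
Proof.
have adjl (X Y : 'M[R]_3) : inner (B *m X) Y = inner (B *m Y) X.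
  by rewrite inner_mull tr_symmx innerC.
have adjr (X Y : 'M[R]_3) : inner (X *m B) Y = inner (Y *m B) X.
  by rewrite inner_mulr tr_symmx innerC.
move=> D E; rewrite [RHS]innerC !inner_Acirc.
congr (_ + _ * _ + _ * _ + _ * _).
- by rewrite !innerDl adjr adjl.
- exact: innerC.
- by rewrite !(innerC _ (comm B _)) !innerDl adjr adjl.
- by rewrite [LHS]innerC adjr [LHS]innerC adjl [LHS]innerC mulmxA.
Qed.

Lemma Acirc_posdef nu1 nu2 nu3 : posdef3 B ->
  0 <= nu1 -> 0 <= nu2 -> 0 <= nu3 -> posdef4 (Acirc nu1 nu2 nu3 B).
Proof.
move=> posB nu1_ge0 nu2_ge0 nu3_ge0 D D_neq0; have := comm_anti D.
rewrite inner_Acirc inner_anticomm; move: (comm B D) => W tW.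
rewrite [inner W (_ + _)]innerC innerDl.
rewrite [inner W (_ *m _ *m _)]innerC.
have -> : inner (W *m B) W = inner (B *m W) W.
  by rewrite -inner_tr trmx_mul tr_symmx tW mulmxN innerNl innerNr opprK.
apply: ltr_pwDl; last first.
  by rewrite mulr_ge0 ?divr_ge0 // inner_conj_ge0 // tr_symmx.
apply: ltr_pwDl; last first.
  by rewrite mulr_ge0 ?divr_ge0 // addr_ge0 // inner_mull_ge0.
apply: ltr_pwDl; last by rewrite mulr_ge0 ?divr_ge0 // inner_ge0.
by rewrite mulr_gt0 // inner_mull_gt0.
Qed.

End Acirc.

Theorem lemma2p5 (R : realType) (B : Sym3 R) (nu1 nu2 nu3 : R)
  (hB : posdef3 B) (hnu1 : 0 <= nu1) (hnu2 : 0 <= nu2) (hnu3 : 0 <= nu3) :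
  [/\ posdef4 (Acirc nu1 nu2 nu3 B),
      forall D : Sym3 R, D != 0 ->
        inner (Acirc nu1 nu2 nu3 B D) D
          = 2 * inner (B *m D) D
            + nu1 / 2 * fnorm (comm B D) ^+ 2
            + nu2 * inner (symmx B ^+ 2 *m D) (comm B D)
            + nu3 * inner (symmx B ^+ 2 *m D *m B) (comm B D)
        /\ 0 < 2 * inner (B *m D) D
               + nu1 / 2 * fnorm (comm B D) ^+ 2
               + nu2 * inner (symmx B ^+ 2 *m D) (comm B D)
               + nu3 * inner (symmx B ^+ 2 *m D *m B) (comm B D)
    & Sym4pp (Acirc nu1 nu2 nu3 B)].
Proof.
have posA := Acirc_posdef _ _ _ _ _ hB hnu1 hnu2 hnu3.
have symA := Acirc_major_symmetric R B nu1 nu2 nu3.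
split=> // [D D_neq0|].
  by rewrite -inner_Acirc_diag; split=> //; apply: posA.
by split=> //; apply: major_symmetric_linear.
Qed.
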